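(* Let $(\mathcal{A},\mathbb{E}_{\mathcal{A}},\mathfrak{s}_{\mathcal{A}})$ and $(\mathcal{B},\mathbb{E}_{\mathcal{B}},\mathfrak{s}_{\mathcal{B}})$ be extriangulated categories, and let $\mathcal{I}_{\mathcal{A}}\subseteq\mathcal{M}_{\mathcal{A}}$ and $\mathcal{I}_{\mathcal{B}}\subseteq\mathcal{M}_{\mathcal{B}}$ be two sets of morphisms which satisfy $\overline{\mathcal{I}_{\mathcal{A}}}=p(\mathcal{I}_{\mathcal{A}})$, $\overline{\mathcal{I}_{\mathcal{B}}}=p(\mathcal{I}_{\mathcal{B}})$, (M0), (MR1), (MR2), (MR3) and (MR4). Let $F:\mathcal{A}\to\mathcal{B}$ be an exact functor which sends $\mathcal{I}_{\mathcal{A}}$ to $\mathcal{I}_{\mathcal{B}}$, and suppose that $F$ admits a right adjoint functor $G:\mathcal{B}\to\mathcal{A}$ such that $G$ is exact and sends $\mathcal{I}_{\mathcal{B}}$ to $\mathcal{I}_{\mathcal{A}}$. Then there exists an adjoint pair $(\widetilde{F},\widetilde{G})$, where $\widetilde{F}:\widetilde{\mathcal{A}}\to\widetilde{\mathcal{B}}$ and $\widetilde{G}:\widetilde{\mathcal{B}}\to\widetilde{\mathcal{A}}$ are both exact functors, with $\widetilde{F}Q_{\mathcal{A}}=Q_{\mathcal{B}}F$ and $\widetilde{G}Q_{\mathcal{B}}=Q_{\mathcal{A}}G$.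
   Context: Extriangulated categories (Nakaoka--Palu). An extriangulated category is a triple $(\mathcal{C},\mathbb{E},\mathfrak{s})$ where $\mathcal{C}$ is an additive category, $\mathbb{E}:\mathcal{C}^{\mathrm{op}}\times\mathcal{C}\to\mathrm{Ab}$ is an additive bifunctor (write $a_*\delta=\mathbb{E}(C,a)(\delta)$ and $c^*\delta=\mathbb{E}(c,A)(\delta)$), and $\mathfrak{s}$ assigns to each $\delta\in\mathbb{E}(C,A)$ an equivalence class $\mathfrak{s}(\delta)=[A\xrightarrow{x}B\xrightarrow{y}C]$ (two such sequences are equivalent if there is an isomorphism of the middle terms compatible with the identities of $A$ and $C$), such that: (i) if $\mathfrak{s}(\delta)=[A\xrightarrow{x}B\xrightarrow{y}C]$, $\mathfrak{s}(\delta')=[A'\xrightarrow{x'}B'\xrightarrow{y'}C']$ and $a:A\to A'$, $c:C\to C'$ satisfy $a_*\delta=c^*\delta'$, there is $b:B\to B'$ with $bx=x'a$, $y'b=cy$; (ii) $\mathfrak{s}(0)$ is the split sequence and $\mathfrak{s}(\delta\oplus\delta')=\mathfrak{s}(\delta)\oplus\mathfrak{s}(\delta')$; (ET3) for $\delta,\delta'$ realized as in (i) and $a,b$ with $bx=x'a$ there is $c$ with $cy=y'b$ and $a_*\delta=c^*\delta'$; (ET3)$^{\mathrm{op}}$ its dual; (ET4) if $\delta\in\mathbb{E}(D,A)$, $\delta'\in\mathbb{E}(F,B)$ are realized by $A\xrightarrow{f}B\xrightarrow{f'}D$ and $B\xrightarrow{g}C\xrightarrow{g'}F$, there are $E$,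 $\delta''\in\mathbb{E}(E,A)$ realized by $A\xrightarrow{gf}C\xrightarrow{h'}E$, and $d:D\to E$, $e:E\to F$ with $h'g=df'$, $eh'=g'$, $D\xrightarrow{d}E\xrightarrow{e}F$ realizing $f'_*\delta'$, $d^*\delta''=\delta$, $f_*\delta''=e^*\delta'$; (ET4)$^{\mathrm{op}}$ its dual. If $\mathfrak{s}(\delta)=[A\xrightarrow{x}B\xrightarrow{y}C]$, the sequence is a conflation, $x$ is an inflation, $y$ is a deflation, and $A\xrightarrow{x}B\xrightarrow{y}C\overset{\delta}{\dashrightarrow}$ is an $\mathbb{E}$-triangle. Exact functor. An additive covariant functor $F:\mathcal{A}\to\mathcal{B}$ between extriangulated categories is exact if there is a natural transformation $\eta:\mathbb{E}_{\mathcal{A}}(-,-)\Rightarrow\mathbb{E}_{\mathcal{B}}(F(-),F(-))$ such that $\mathfrak{s}_{\mathcal{B}}(\eta_{(C,A)}(\delta))=[F(A)\xrightarrow{F(x)}F(B)\xrightarrow{F(y)}F(C)]$ whenever $\mathfrak{s}_{\mathcal{A}}(\delta)=[A\xrightarrow{x}B\xrightarrow{y}C]$. Localization. $\mathcal{M}_{\mathcal{A}}$ is the class of all morphisms of $\mathcal{A}$. For $\mathcal{I}\subseteq\mathcal{M}_{\mathcal{A}}$ closed under composition and containing all identities, $N_{\mathcal{I}}$ is the full subcategory of objects $N$ such that $N\to0$ and $0\to N$ both belong to $\mathcal{I}$; $\overline{\mathcal{A}}=\mathcal{A}/[N_{\mathcal{I}}]$ is the ideal quotient (same objects, morphisms modulo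 those factoring through an object of $N_{\mathcal{I}}$), $p:\mathcal{A}\to\overline{\mathcal{A}}$ is the quotient functor, $\overline{f}=p(f)$, and $\overline{\mathcal{I}}$ is the closure of $p(\mathcal{I})$ under composition with isomorphisms of $\overline{\mathcal{A}}$. The conditions are: (M0) $\mathcal{I}$ contains all isomorphisms, is closed under composition, and is closed under finite direct sums. (MR1) $\overline{\mathcal{I}}$ satisfies 2-out-of-3 with respect to compositions. (MR2) $\overline{\mathcal{I}}$ is a multiplicative system in $\overline{\mathcal{A}}$ (left and right calculus of fractions). (MR3) For $\mathbb{E}$-triangles $A\xrightarrow{x}B\xrightarrow{y}C\overset{\delta}{\dashrightarrow}$, $A'\xrightarrow{x'}B'\xrightarrow{y'}C'\overset{\delta'}{\dashrightarrow}$ and morphisms $a:A\to A'$, $c:C\to C'$ with $a_*\delta=c^*\delta'$: if $\overline{a},\overline{c}\in\overline{\mathcal{I}}$, there is $\mathbf{b}\in\overline{\mathcal{I}}(B,B')$ with $\mathbf{b}\circ\overline{x}=\overline{x'}\circ\overline{a}$ and $\overline{c}\circ\overline{y}=\overline{y'}\circ\mathbf{b}$. (MR4) $\{\mathbf{v}\circ\overline{x}\circ\mathbf{u}\mid x\text{ an inflation},\ \mathbf{u},\mathbf{v}\in\overline{\mathcal{I}}\}$ and $\{\mathbf{v}\circ\overline{y}\circ\mathbf{u}\mid y\text{ a deflation},\ \mathbf{u},\mathbf{v}\in\overline{\mathcal{I}}\}$ are closed under composition. By a theorem of Nakaoka--Ogawa--Sakai, if $\mathcal{I}$ satisfies (M0),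 (MR1)--(MR4), then the localization $\widetilde{\mathcal{A}}$ of $\overline{\mathcal{A}}$ at $\overline{\mathcal{I}}$ carries an extriangulated structure $(\widetilde{\mathcal{A}},\widetilde{\mathbb{E}},\widetilde{\mathfrak{s}})$ and the composite $Q_{\mathcal{A}}:\mathcal{A}\xrightarrow{p}\overline{\mathcal{A}}\to\widetilde{\mathcal{A}}$ is an exact functor (with a natural transformation $\mu:\mathbb{E}\Rightarrow\widetilde{\mathbb{E}}\circ(Q^{\mathrm{op}}\times Q)$), universal among exact functors inverting $\mathcal{I}$. Here $\widetilde{\mathcal{A}}$ and $\widetilde{\mathcal{B}}$ are the localizations of $\mathcal{A}$ by $\mathcal{I}_{\mathcal{A}}$ and of $\mathcal{B}$ by $\mathcal{I}_{\mathcal{B}}$. *)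

(* Defs.v *)
From HB Require Import structures.
From mathcomp Require Import all_boot all_algebra.
From mathcomp Require Import boolp.

Set Implicit Arguments.
Unset Strict Implicit.
Unset Printing Implicit Defensive.

Import GRing.Theory.

Local Open Scope ring_scope.
Local Open Scope quotient_scope.

(** * Categories and functors *)

Reserved Notation "g \oc f" (at level 40, left associativity).

Record category := Category {
  obj :> Type;
  hom : obj -> obj -> Type;
  idm : forall X, hom X X;
  compm : forall X Y Z, hom Y Z -> hom X Y -> hom X Z;
  comp1m : forall X Y (f : hom X Y), compm (idm Y) f = f;
  compm1 : forall X Y (f : hom X Y), compm f (idm X) = f;
  compmA : forall W X Y Z (h : hom Y Z) (g : hom X Y) (f : hom W X),
    compm h (compm g f) = compm (compm h g) f }.

Arguments hom {c} X Y.
Arguments idm {c} X.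
Arguments compm {c X Y Z} g f.

Notation "g \oc f" := (compm g f).

Definition is_iso (C : category) (X Y : C) (f : hom X Y) : Prop :=
  exists g : hom Y X, g \oc f = idm X /\ f \oc g = idm Y.

Record functor (C D : category) := Functor {
  fob :> C -> D;
  fmap : forall X Y, hom X Y -> hom (fob X) (fob Y);
  fmap1 : forall X, fmap (idm X) = idm (fob X);
  fmapM : forall X Y Z (g : hom Y Z) (f : hom X Y),
    fmap (g \oc f) = fmap g \oc fmap f }.

Arguments fmap {C D} F {X Y} f : rename.

Section CompFunctor.
Variables (C D E : category) (G : functor D E) (F : functor C D).

Lemma comp_fmap1 (X : C) : fmap G (fmap F (idm X)) = idm (G (F X)).
Proof. by rewrite !fmap1. Qed.

Lemma comp_fmapM (X Y Z : C) (g : hom Y Z) (f : hom X Y) :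
  fmap G (fmap F (g \oc f)) = fmap G (fmap F g) \oc fmap G (fmap F f).
Proof. by rewrite !fmapM. Qed.

Definition comp_functor : functor C E :=
  Functor (fmap := fun X Y f => fmap G (fmap F f)) comp_fmap1 comp_fmapM.
End CompFunctor.

Record is_adjoint_by (C D : category) (F : functor C D) (G : functor D C)
    (eta : forall X : C, hom X (G (F X)))
    (eps : forall Y : D, hom (F (G Y)) Y) : Prop := IsAdjointBy {
  unit_natural : forall (X X' : C) (f : hom X X'),
    eta X' \oc f = fmap G (fmap F f) \oc eta X;
  counit_natural : forall (Y Y' : D) (g : hom Y Y'),
    g \oc eps Y = eps Y' \oc fmap F (fmap G g);
  triangle_left : forall X : C, eps (F X) \oc fmap F (eta X) = idm (F X);
  triangle_right : forall Y : D, fmap G (eps Y) \oc eta (G Y) = idm (G Y) }.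

(* G is right adjoint to F. *)
Definition is_adjoint (C D : category) (F : functor C D) (G : functor D C) :
  Prop := exists eta eps, @is_adjoint_by C D F G eta eps.

Definition mor_class (C : category) := forall X Y : C, hom X Y -> Prop.

Definition inverts (C D : category) (F : functor C D) (S : mor_class C) :
  Prop := forall (X Y : C) (f : hom X Y), S X Y f -> is_iso (fmap F f).

(* Gabriel-Zisman localization: the universal property is strict (equality of
   functors), so that L is bijective on objects. *)
Definition is_localization (C D : category) (L : functor C D)
    (S : mor_class C) : Prop :=
  inverts L S /\
  forall (T : category) (H : functor C T), inverts H S ->
    exists! K : functor D T, comp_functor K L = H.

(** * Additive categories *)

Record hom_additive := HomAdditive {
  ha_cat :> category;
  ha_zmod : forall X Y : ha_cat, GRing.Zmodule (hom X Y) }.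

HB.instance Definition _ (C : hom_additive) (X Y : C) := ha_zmod X Y.

Record additive_category := AdditiveCategory {
  ac_cat :> hom_additive;
  compmDl : forall (X Y Z : ac_cat) (g h : hom Y Z) (f : hom X Y),
    (g + h) \oc f = g \oc f + h \oc f;
  compmDr : forall (X Y Z : ac_cat) (g : hom Y Z) (f h : hom X Y),
    g \oc (f + h) = g \oc f + g \oc h;
  zero_ob : ac_cat;
  to_zero : forall (X : ac_cat) (f : hom X zero_ob), f = 0;
  from_zero : forall (X : ac_cat) (f : hom zero_ob X), f = 0;
  biprod : ac_cat -> ac_cat -> ac_cat;
  inj1 : forall X Y, hom X (biprod X Y);
  inj2 : forall X Y, hom Y (biprod X Y);
  prj1 : forall X Y, hom (biprod X Y) X;
  prj2 : forall X Y, hom (biprod X Y) Y;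
  prj1_inj1 : forall X Y, prj1 X Y \oc inj1 X Y = idm X;
  prj2_inj2 : forall X Y, prj2 X Y \oc inj2 X Y = idm Y;
  prj1_inj2 : forall X Y, prj1 X Y \oc inj2 X Y = 0;
  prj2_inj1 : forall X Y, prj2 X Y \oc inj1 X Y = 0;
  biprod_id : forall X Y,
    inj1 X Y \oc prj1 X Y + inj2 X Y \oc prj2 X Y = idm (biprod X Y) }.

Arguments zero_ob {a}.
Arguments biprod {a} X Y.
Arguments inj1 {a} X Y.
Arguments inj2 {a} X Y.
Arguments prj1 {a} X Y.
Arguments prj2 {a} X Y.

Definition dsum_mor (C : additive_category) (X X' Y Y' : C)
    (f : hom X Y) (g : hom X' Y') : hom (biprod X X') (biprod Y Y') :=
  inj1 Y Y' \oc f \oc prj1 X X' + inj2 Y Y' \oc g \oc prj2 X X'.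

Definition is_additive (C D : additive_category) (F : functor C D) : Prop :=
  forall (X Y : C) (f g : hom X Y), fmap F (f + g) = fmap F f + fmap F g.

(** * Extriangulated categories *)

(* [ext Z X] is E(Z, X): contravariant in Z, covariant in X. *)
Record ext_bifunctor (C : additive_category) := ExtBifunctor {
  ext : C -> C -> zmodType;
  push : forall Z X X' : C, hom X X' -> ext Z X -> ext Z X';
  pull : forall Z' Z X : C, hom Z' Z -> ext Z X -> ext Z' X;
  push1 : forall (Z X : C) (d : ext Z X), push (idm X) d = d;
  pushM : forall (Z X X' X'' : C) (a' : hom X' X'') (a : hom X X')
    (d : ext Z X), push (a' \oc a) d = push a' (push a d);
  pull1 : forall (Z X : C) (d : ext Z X), pull (idm Z) d = d;
  pullM : forall (Z'' Z' Z X : C) (c : hom Z' Z) (c' : hom Z'' Z')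
    (d : ext Z X), pull (c \oc c') d = pull c' (pull c d);
  push_pull : forall (Z' Z X X' : C) (a : hom X X') (c : hom Z' Z)
    (d : ext Z X), push a (pull c d) = pull c (push a d);
  pushD : forall (Z X X' : C) (a : hom X X') (d d' : ext Z X),
    push a (d + d') = push a d + push a d';
  pullD : forall (Z' Z X : C) (c : hom Z' Z) (d d' : ext Z X),
    pull c (d + d') = pull c d + pull c d';
  pushDl : forall (Z X X' : C) (a a' : hom X X') (d : ext Z X),
    push (a + a') d = push a d + push a' d;
  pullDl : forall (Z' Z X : C) (c c' : hom Z' Z) (d : ext Z X),
    pull (c + c') d = pull c d + pull c' d }.

Arguments push {C e Z X X'} a d.
Arguments pull {C e Z' Z X} c d.

Definition dsum_ext (C : additive_category) (E : ext_bifunctor C)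
    (Z Z' X X' : C) (d : ext E Z X) (d' : ext E Z' X') :
    ext E (biprod Z Z') (biprod X X') :=
  push (inj1 X X') (pull (prj1 Z Z') d) +
  push (inj2 X X') (pull (prj2 Z Z') d').

Record sequence (C : category) (X Z : C) := Sequence {
  mid : C;
  seq_in : hom X mid;
  seq_out : hom mid Z }.

Arguments Sequence {C X Z mid} seq_in seq_out.

Definition seq_equiv (C : category) (X Z : C) (s t : sequence X Z) : Prop :=
  exists b : hom (mid s) (mid t),
    [/\ is_iso b, b \oc seq_in s = seq_in t & seq_out t \oc b = seq_out s].

(* The realization maps d to the set of sequences [realizes d]; the field
   [realizes_class] says that this set is exactly one equivalence class. *)
Record extriangulated := Extriangulated {
  et_cat :> additive_category;
  et_ext : ext_bifunctor et_cat;
  realizes : forall Z X : et_cat, ext et_ext Z X -> sequence X Z -> Prop;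
  realizes_class : forall (Z X : et_cat) (d : ext et_ext Z X),
    exists s, forall t, realizes d t <-> seq_equiv s t;
  realizes_mor : forall (A B C A' B' C' : et_cat)
    (d : ext et_ext C A) (d' : ext et_ext C' A')
    (x : hom A B) (y : hom B C) (x' : hom A' B') (y' : hom B' C')
    (a : hom A A') (c : hom C C'),
    realizes d (Sequence x y) -> realizes d' (Sequence x' y') ->
    push a d = pull c d' ->
    exists b : hom B B', b \oc x = x' \oc a /\ y' \oc b = c \oc y;
  realizes0 : forall A C : et_cat,
    realizes (0 : ext et_ext C A) (Sequence (inj1 A C) (prj2 A C));
  realizes_dsum : forall (A B C A' B' C' : et_cat)
    (d : ext et_ext C A) (d' : ext et_ext C' A')
    (x : hom A B) (y : hom B C) (x' : hom A' B') (y' : hom B' C'),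
    realizes d (Sequence x y) -> realizes d' (Sequence x' y') ->
    realizes (dsum_ext d d') (Sequence (dsum_mor x x') (dsum_mor y y'));
  ET3 : forall (A B C A' B' C' : et_cat)
    (d : ext et_ext C A) (d' : ext et_ext C' A')
    (x : hom A B) (y : hom B C) (x' : hom A' B') (y' : hom B' C')
    (a : hom A A') (b : hom B B'),
    realizes d (Sequence x y) -> realizes d' (Sequence x' y') ->
    b \oc x = x' \oc a ->
    exists c : hom C C', c \oc y = y' \oc b /\ push a d = pull c d';
  ET3op : forall (A B C A' B' C' : et_cat)
    (d : ext et_ext C A) (d' : ext et_ext C' A')
    (x : hom A B) (y : hom B C) (x' : hom A' B') (y' : hom B' C')
    (b : hom B B') (c : hom C C'),
    realizes d (Sequence x y) -> realizes d' (Sequence x' y') ->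
    c \oc y = y' \oc b ->
    exists a : hom A A', b \oc x = x' \oc a /\ push a d = pull c d';
  ET4 : forall (A B C D F : et_cat)
    (d : ext et_ext D A) (d' : ext et_ext F B)
    (f : hom A B) (f' : hom B D) (g : hom B C) (g' : hom C F),
    realizes d (Sequence f f') -> realizes d' (Sequence g g') ->
    exists (E : et_cat) (d'' : ext et_ext E A) (h' : hom C E)
      (u : hom D E) (v : hom E F),
      realizes d'' (Sequence (g \oc f) h') /\
      [/\ h' \oc g = u \oc f', v \oc h' = g',
          realizes (push f' d') (Sequence u v),
          pull u d'' = d & push f d'' = pull v d'];
  ET4op : forall (A B C D F : et_cat)
    (d : ext et_ext A D) (d' : ext et_ext B F)
    (f : hom B A) (f' : hom D B) (g : hom C B) (g' : hom F C),
    realizes d (Sequence f' f) -> realizes d' (Sequence g' g) ->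
    exists (E : et_cat) (d'' : ext et_ext A E) (h' : hom E C)
      (u : hom E D) (v : hom F E),
      realizes d'' (Sequence h' (f \oc g)) /\
      [/\ g \oc h' = f' \oc u, h' \oc v = g',
          realizes (pull f' d') (Sequence v u),
          push u d'' = d & pull f d'' = push v d'] }.

Arguments et_ext {e}.
Arguments realizes {e Z X} d s.

Definition is_inflation (A : extriangulated) (X Y : A) (x : hom X Y) : Prop :=
  exists (Z : A) (y : hom Y Z) (d : ext et_ext Z X), realizes d (Sequence x y).

Definition is_deflation (A : extriangulated) (Y Z : A) (y : hom Y Z) : Prop :=
  exists (X : A) (x : hom X Y) (d : ext et_ext Z X), realizes d (Sequence x y).

(** * Exact functors *)

Record exact_structure (A B : extriangulated) (F : functor A B) :=
    ExactStructure {
  ex_additive : is_additive F;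
  ex_nat : forall Z X : A, ext et_ext Z X -> ext et_ext (F Z) (F X);
  ex_natD : forall (Z X : A) (d d' : ext et_ext Z X),
    ex_nat (d + d') = ex_nat d + ex_nat d';
  ex_push : forall (Z X X' : A) (a : hom X X') (d : ext et_ext Z X),
    ex_nat (push a d) = push (fmap F a) (ex_nat d);
  ex_pull : forall (Z' Z X : A) (c : hom Z' Z) (d : ext et_ext Z X),
    ex_nat (pull c d) = pull (fmap F c) (ex_nat d);
  ex_realizes : forall (X Y Z : A) (d : ext et_ext Z X)
    (x : hom X Y) (y : hom Y Z), realizes d (Sequence x y) ->
    realizes (ex_nat d) (Sequence (fmap F x) (fmap F y)) }.

Arguments ex_nat {A B F} e {Z X} d.

Definition is_exact (A B : extriangulated) (F : functor A B) : Prop :=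
  inhabited (exact_structure F).

(* A functor together with the natural transformation making it exact. *)
Record exact_functor (A B : extriangulated) := ExactFunctor {
  ef_fun :> functor A B;
  ef_str : exact_structure ef_fun }.

Section CompExact.
Variables (A B D : extriangulated) (G : exact_functor B D).
Variable (F : exact_functor A B).

Definition comp_nat (Z X : A) (d : ext et_ext Z X) :
    ext et_ext (G (F Z)) (G (F X)) :=
  ex_nat (ef_str G) (ex_nat (ef_str F) d).

Lemma comp_additive : is_additive (comp_functor G F).
Proof.
by move=> X Y f g /=; rewrite (ex_additive (ef_str F)) (ex_additive (ef_str G)).
Qed.

Lemma comp_natD (Z X : A) (d d' : ext et_ext Z X) :
  comp_nat (d + d') = comp_nat d + comp_nat d'.
Proof. by rewrite /comp_nat !ex_natD. Qed.

Lemma comp_push (Z X X' : A) (a : hom X X') (d : ext et_ext Z X) :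
  comp_nat (push a d) = push (fmap (comp_functor G F) a) (comp_nat d).
Proof. by rewrite /comp_nat !ex_push. Qed.

Lemma comp_pull (Z' Z X : A) (c : hom Z' Z) (d : ext et_ext Z X) :
  comp_nat (pull c d) = pull (fmap (comp_functor G F) c) (comp_nat d).
Proof. by rewrite /comp_nat !ex_pull. Qed.

Lemma comp_realizes (X Y Z : A) (d : ext et_ext Z X) (x : hom X Y)
    (y : hom Y Z) : realizes d (Sequence x y) ->
  realizes (comp_nat d) (Sequence (fmap (comp_functor G F) x)
                              (fmap (comp_functor G F) y)).
Proof. by move=> dxy; do 2!apply: ex_realizes. Qed.

Definition comp_exact : exact_functor A D :=
  ExactFunctor (ef_fun := comp_functor G F)
    (ExactStructure comp_additive comp_natD comp_push comp_pull comp_realizes).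
End CompExact.

(** * The ideal quotient by the null objects of a class of morphisms *)

Record cond_M0 (A : extriangulated) (I : mor_class A) : Prop := CondM0 {
  M0_iso : forall (X Y : A) (f : hom X Y), is_iso f -> I X Y f;
  M0_comp : forall (X Y Z : A) (g : hom Y Z) (f : hom X Y),
    I Y Z g -> I X Y f -> I X Z (g \oc f);
  M0_dsum : forall (X X' Y Y' : A) (f : hom X Y) (g : hom X' Y'),
    I X Y f -> I X' Y' g ->
    I (biprod X X') (biprod Y Y') (dsum_mor f g) }.

Definition null_object (A : extriangulated) (I : mor_class A) (N : A) : Prop :=
  I N zero_ob 0 /\ I zero_ob N 0.

Definition factors_null (A : extriangulated) (I : mor_class A) (X Y : A)
    (f : hom X Y) : Prop :=
  exists (N : A) (v : hom N Y) (u : hom X N), null_object I N /\ f = v \oc u.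

Section AdditiveTheory.
Variable C : additive_category.

Lemma comp0m (X Y Z : C) (f : hom X Y) : (0 : hom Y Z) \oc f = 0.
Proof. by apply: (addrI (0 \oc f)); rewrite -compmDl !addr0. Qed.

Lemma compm0 (X Y Z : C) (g : hom Y Z) : g \oc (0 : hom X Y) = 0.
Proof. by apply: (addrI (g \oc 0)); rewrite -compmDr !addr0. Qed.

Lemma compmBl (X Y Z : C) (g h : hom Y Z) (f : hom X Y) :
  (g - h) \oc f = g \oc f - h \oc f.
Proof.
by apply: (addIr (h \oc f)); rewrite -compmDl !subrK.
Qed.

Lemma compmBr (X Y Z : C) (g : hom Y Z) (f h : hom X Y) :
  g \oc (f - h) = g \oc f - g \oc h.
Proof.
by apply: (addIr (g \oc h)); rewrite -compmDr !subrK.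
Qed.

Lemma iso_zero (X Y : C) :
  idm X = 0 -> idm Y = 0 -> is_iso (0 : hom X Y).
Proof. by move=> X0 Y0; exists 0; rewrite X0 Y0 !comp0m. Qed.

Lemma biprod_zero_id : idm (biprod zero_ob zero_ob : C) = 0.
Proof.
by rewrite -biprod_id (to_zero (prj1 _ _)) (to_zero (prj2 _ _)) !compm0 addr0.
Qed.
End AdditiveTheory.

Section IdealQuotient.
Variables (A : extriangulated) (I : mor_class A) (hI : cond_M0 I).

Lemma null_biprod (N N' : A) :
  null_object I N -> null_object I N' -> null_object I (biprod N N').
Proof.
move=> [N0 N0'] [N'0 N'0'].
have z0 := biprod_zero_id A; have z1 := to_zero (idm (zero_ob : A)).
split.
  have /(M0_comp hI) := M0_iso hI (iso_zero z0 z1).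
  by move=> /(_ _ _ (M0_dsum hI N0 N'0)); rewrite comp0m.
have := M0_comp hI (M0_dsum hI N0' N'0') (M0_iso hI (iso_zero z1 z0)).
by rewrite compm0.
Qed.

Definition null_ideal (X Y : A) : {pred hom X Y} :=
  fun f => `[< factors_null I f >].

Lemma null_ideal_closed (X Y : A) : zmod_closed (@null_ideal X Y).
Proof.
split=> [|f g /asboolP[N [v [u [nN ->]]]] /asboolP[N' [v' [u' [nN' ->]]]]].
  apply/asboolP; exists zero_ob, 0, 0; rewrite comp0m; split=> //.
  have z1 := to_zero (idm (zero_ob : A)).
  by split; apply/(M0_iso hI)/iso_zero.
apply/asboolP; exists (biprod N N').
exists (v \oc prj1 N N' - v' \oc prj2 N N'), (inj1 N N' \oc u + inj2 N N' \oc u').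
split; first exact: null_biprod.
rewrite compmDr !compmBl !compmA -!(compmA _ _ (inj1 _ _)) -!(compmA _ _ (inj2 _ _)).
by rewrite prj1_inj1 prj2_inj2 prj1_inj2 prj2_inj1 !compm0 !compm1 !comp0m
  subr0 sub0r.
Qed.

Definition null_zmod (X Y : A) : zmodClosed (hom X Y) :=
  HB.pack (@null_ideal X Y)
    (GRing.isZmodClosed.Build (hom X Y) (@null_ideal X Y)
       (null_ideal_closed X Y)).

(* The hom group of A / [N_I]. *)
Definition qhom (X Y : A) : Type := Quotient.quot (null_zmod X Y).

Definition qclass (X Y : A) (f : hom X Y) : qhom X Y :=
  \pi_(Quotient.quot (null_zmod X Y)) f.

Definition qrepr (X Y : A) (f : qhom X Y) : hom X Y := repr f.

Lemma qreprK (X Y : A) (f : qhom X Y) : qclass (qrepr f) = f.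
Proof. exact: reprK. Qed.

Lemma qclassP (X Y : A) (f g : hom X Y) :
  qclass f = qclass g <-> factors_null I (f - g).
Proof.
split=> [/eqP|fg]; first by rewrite /qclass -Quotient.idealrBE => /asboolP.
by apply/eqP; rewrite /qclass -Quotient.idealrBE; apply/asboolP.
Qed.

Definition qcomp (X Y Z : A) (g : qhom Y Z) (f : qhom X Y) : qhom X Z :=
  qclass (qrepr g \oc qrepr f).

Lemma qcompE (X Y Z : A) (g : hom Y Z) (f : hom X Y) :
  qcomp (qclass g) (qclass f) = qclass (g \oc f).
Proof.
have /qclassP[N [v [u [nN eg]]]] := qreprK (qclass g).
have /qclassP[N' [v' [u' [nN' ef]]]] := qreprK (qclass f).
transitivity (qclass (qrepr (qclass g) \oc f)); apply/qclassP.
  by exists N', (qrepr (qclass g) \oc v'), u'; rewrite -compmBr ef compmA.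
by exists N, v, (u \oc f); rewrite -compmBl eg compmA.
Qed.

Lemma qcomp1m (X Y : A) (f : qhom X Y) : qcomp (qclass (idm Y)) f = f.
Proof. by rewrite -[f]qreprK qcompE comp1m. Qed.

Lemma qcompm1 (X Y : A) (f : qhom X Y) : qcomp f (qclass (idm X)) = f.
Proof. by rewrite -[f]qreprK qcompE compm1. Qed.

Lemma qcompA (W X Y Z : A) (h : qhom Y Z) (g : qhom X Y) (f : qhom W X) :
  qcomp h (qcomp g f) = qcomp (qcomp h g) f.
Proof. by rewrite -[f]qreprK -[g]qreprK -[h]qreprK !qcompE compmA. Qed.

Definition ideal_quotient : category := Category qcomp1m qcompm1 qcompA.

Definition quot_functor : functor A ideal_quotient :=
  @Functor A ideal_quotient id qclass
    (fun=> erefl) (fun X Y Z g f => esym (qcompE g f)).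

Inductive image_class : mor_class ideal_quotient :=
  ImageClass (X Y : A) (f : hom X Y) of I f :
    image_class (fmap quot_functor f).

(* The closure of p(I) under composition with isomorphisms. *)
Inductive bar_class : mor_class ideal_quotient :=
| BarImage (X Y : ideal_quotient) (f : hom X Y) of
    image_class f : bar_class f
| BarIsoL (X Y Z : ideal_quotient) (u : hom Y Z) (f : hom X Y) of
    is_iso u & bar_class f : bar_class (u \oc f)
| BarIsoR (X Y Z : ideal_quotient) (f : hom Y Z) (u : hom X Y) of
    is_iso u & bar_class f : bar_class (f \oc u).

End IdealQuotient.

(** * The conditions (MR1)-(MR4) *)

Definition comp_closed (C : category) (S : mor_class C) : Prop :=
  forall (X Y Z : C) (g : hom Y Z) (f : hom X Y),
    S Y Z g -> S X Y f -> S X Z (g \oc f).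

Definition two_out_of_three (C : category) (S : mor_class C) : Prop :=
  forall (X Y Z : C) (g : hom Y Z) (f : hom X Y),
    [/\ S X Y f -> S Y Z g -> S X Z (g \oc f),
        S X Y f -> S X Z (g \oc f) -> S Y Z g &
        S Y Z g -> S X Z (g \oc f) -> S X Y f].

Record multiplicative_system (C : category) (S : mor_class C) : Prop :=
    MultiplicativeSystem {
  ms_id : forall X : C, S X X (idm X);
  ms_comp : comp_closed S;
  ms_left_ore : forall (X Y Z : C) (s : hom X Y) (f : hom X Z), S X Y s ->
    exists (W : C) (t : hom Z W) (g : hom Y W),
      S Z W t /\ t \oc f = g \oc s;
  ms_right_ore : forall (X Y Z : C) (s : hom Y X) (f : hom Z X), S Y X s ->
    exists (W : C) (t : hom W Z) (g : hom W Y),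
      S W Z t /\ f \oc t = s \oc g;
  ms_left_cancel : forall (W X Y : C) (s : hom W X) (f g : hom X Y),
    S W X s -> f \oc s = g \oc s ->
    exists (Z : C) (t : hom Y Z), S Y Z t /\ t \oc f = t \oc g;
  ms_right_cancel : forall (X Y Z : C) (s : hom Y Z) (f g : hom X Y),
    S Y Z s -> s \oc f = s \oc g ->
    exists (W : C) (t : hom W X), S W X t /\ f \oc t = g \oc t }.

(* The morphisms v \oc p(x) \oc u with x in K and u, v in the closure of p(I). *)
Inductive sandwich (A : extriangulated) (I : mor_class A) (hI : cond_M0 I)
    (K : mor_class A) : mor_class (ideal_quotient hI) :=
  Sandwich (W X Y Z : A) (v : hom (Y : ideal_quotient hI) Z) (x : hom X Y)
    (u : hom (W : ideal_quotient hI) X) of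
    bar_class v & K X Y x & bar_class u :
    sandwich K (v \oc fmap (quot_functor hI) x \oc u).

Section Conditions.
Variables (A : extriangulated) (I : mor_class A) (hI : cond_M0 I).

Local Notation p := (quot_functor hI).
Local Notation Ibar := (@bar_class A I hI).

Definition cond_bar : Prop :=
  forall (X Y : ideal_quotient hI) (f : hom X Y),
    bar_class f <-> image_class f.

Definition cond_MR1 : Prop := two_out_of_three Ibar.

Definition cond_MR2 : Prop := multiplicative_system Ibar.

Definition cond_MR3 : Prop :=
  forall (X Y Z X' Y' Z' : A) (d : ext et_ext Z X) (d' : ext et_ext Z' X')
    (x : hom X Y) (y : hom Y Z) (x' : hom X' Y') (y' : hom Y' Z')
    (a : hom X X') (c : hom Z Z'),
    realizes d (Sequence x y) -> realizes d' (Sequence x' y') ->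
    push a d = pull c d' ->
    bar_class (fmap p a) -> bar_class (fmap p c) ->
    exists b : hom (p Y) (p Y'),
      [/\ bar_class b, b \oc fmap p x = fmap p x' \oc fmap p a &
          fmap p c \oc fmap p y = fmap p y' \oc b].

Definition cond_MR4 : Prop :=
  comp_closed (sandwich (hI := hI) (@is_inflation A)) /\
  comp_closed (sandwich (hI := hI) (@is_deflation A)).

(* The localization of A by I, characterized up to unique isomorphism: an
   extriangulated structure on a localization of A / [N_I] at the closure of
   p(I), together with the natural transformation mu making the composite
   Q = loc_fun \o p exact and universal among exact functors inverting I. *)
Record ext_localization := ExtLocalization {
  loc_cat :> extriangulated;
  loc_fun : functor (ideal_quotient hI) loc_cat;
  loc_funP : is_localization loc_fun Ibar;
  loc_mu : exact_structure (comp_functor loc_fun p);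
  loc_universal : forall (D : extriangulated) (H : exact_functor A D),
    inverts H I ->
    exists! K : exact_functor loc_cat D,
      comp_exact K (ExactFunctor loc_mu) = H }.

Definition loc_Q (L : ext_localization) : functor A L :=
  comp_functor (loc_fun L) p.

End Conditions.

(* Main.v *)
From mathcomp Require Import all_boot.
From mathcomp Require Import boolp.
Require Import Defs.

(** The functors [Ft] and [Gt] are the factorizations of the exact functors
    [Q_B F] and [Q_A G] through the universal property of the localizations,
    which apply because [F] and [G] preserve the classes of morphisms to be
    inverted and [Q_A], [Q_B] invert them.  What remains is the adjunction.

    The unit and counit of [F -| G] give, after applying [Q_A] and [Q_B],
    transformations [Q_A X -> Gt Ft Q_A X] and [Ft Gt Q_B Y -> Q_B Y], natural
    with respect to the morphisms of [A] and [B].  They have to be extended to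
    all objects and shown to be natural with respect to all morphisms of the
    localizations, formal inverses included.  Both follow from one principle,
    [localization_section].  Let a localization [L : C -> D] be given, together
    with a structure on the objects of [D] and a notion of structure-preserving
    morphism that is stable under identities, composition and inversion.  Then
    [L] lifts to the category of structured objects as soon as each [L X] is
    given a structure that each [L f] preserves.  The lift inverts what [L]
    inverts, hence factors through [D], and by uniqueness this factorization
    is a section of the forgetful functor.  If a structure on [Z] is a morphism
    [K0 Z -> K1 Z], this extends natural transformations
    ([localization_extend_nat]); if it is a proof of [P Z], it reduces
    statements about the objects of [D] to the objects [L X]
    ([localization_ob_ind]).

    For the triangle identities, the equalities [Ft Q_A = Q_B F] and
    [Gt Q_B = Q_A G] are only used as natural isomorphisms, which avoids all
    transport along equalities of objects.  The identities are checked on the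
    images of [Q_A] and [Q_B], where they reduce to those of [F -| G]
    ([adjoint_descent]). *)

Set Implicit Arguments.
Unset Strict Implicit.
Unset Printing Implicit Defensive.

(** * Functors up to equality of their data *)

Lemma functor_data_eq (C D : category) (o : C -> D)
    (m : forall X Y, hom X Y -> hom (o X) (o Y)) h1 h1' hM hM' :
  @Functor C D o m h1 hM = @Functor C D o m h1' hM'.
Proof.
by rewrite (Prop_irrelevance h1 h1') (Prop_irrelevance hM hM').
Qed.

Definition id_functor (C : category) : functor C C :=
  @Functor C C id (fun X Y f => f) (fun=> erefl) (fun X Y Z g f => erefl).

Lemma comp_id_functor (C D : category) (F : functor C D) :
  comp_functor (id_functor D) F = F.
Proof. by case: F => o m h1 hM; apply: functor_data_eq. Qed.

Lemma comp_functorA (C D E T : category) (H : functor E T) (G : functor D E)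
    (F : functor C D) :
  comp_functor H (comp_functor G F) = comp_functor (comp_functor H G) F.
Proof. exact: functor_data_eq. Qed.

Lemma fmap_cancel (C D : category) (F : functor C D) (X Y : C)
    (f : hom X Y) (g : hom Y X) :
  g \oc f = idm X -> fmap F g \oc fmap F f = idm (F X).
Proof. by move=> gf; rewrite -fmapM gf fmap1. Qed.

Lemma eq_functor_iso (C D : category) (H H' : functor C D) : H = H' ->
  exists (i : forall X, hom (H X) (H' X)) (j : forall X, hom (H' X) (H X)),
    [/\ forall X Y (f : hom X Y), i Y \oc fmap H f = fmap H' f \oc i X,
        forall X Y (f : hom X Y), j Y \oc fmap H' f = fmap H f \oc j X,
        forall X, j X \oc i X = idm (H X) &
        forall X, i X \oc j X = idm (H' X)].
Proof.
move=> <-; exists (fun X => idm (H X)), (fun X => idm (H X)).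
by split=> *; rewrite ?comp1m ?compm1.
Qed.

(** * Structures on the objects of a localization *)

Section StructuredObjects.
Variables (D : category) (E : D -> Type).
Variable R : forall X Y : D, hom X Y -> E X -> E Y -> Prop.
Hypothesis R_id : forall X (e : E X), R (idm X) e e.
Hypothesis R_comp : forall X Y Z (g : hom Y Z) (f : hom X Y) eX eY eZ,
  R g eY eZ -> R f eX eY -> R (g \oc f) eX eZ.

Definition str_hom (U V : {X : D & E X}) : Type :=
  {f : hom (projT1 U) (projT1 V) | R f (projT2 U) (projT2 V)}.

Lemma str_hom_eq (U V : {X : D & E X}) (f g : str_hom U V) :
  sval f = sval g -> f = g.
Proof. exact: eq_sig_hprop. Qed.

Definition str_id (U : {X : D & E X}) : str_hom U U :=
  exist _ (idm (projT1 U)) (R_id (projT2 U)).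

Definition str_comp (U V W : {X : D & E X}) (g : str_hom V W)
    (f : str_hom U V) : str_hom U W :=
  exist _ (sval g \oc sval f) (R_comp (svalP g) (svalP f)).

Lemma str_comp1m U V (f : str_hom U V) : str_comp (str_id V) f = f.
Proof. by apply: str_hom_eq; apply: comp1m. Qed.

Lemma str_compm1 U V (f : str_hom U V) : str_comp f (str_id U) = f.
Proof. by apply: str_hom_eq; apply: compm1. Qed.

Lemma str_compA U V W T (h : str_hom W T) (g : str_hom V W)
    (f : str_hom U V) :
  str_comp h (str_comp g f) = str_comp (str_comp h g) f.
Proof. by apply: str_hom_eq; apply: compmA. Qed.

Definition str_cat : category := Category str_comp1m str_compm1 str_compA.

Definition str_forget : functor str_cat D :=
  @Functor str_cat D (@projT1 D E) (fun U V f => sval f)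
    (fun=> erefl) (fun U V W g f => erefl).

(** A strict section of the forgetful functor is a choice of structures that
    all morphisms preserve.  The first conjunct identifies these structures
    without transport along the equality of objects. *)
Lemma section_of_forget (K : functor D str_cat) :
  comp_functor str_forget K = id_functor D ->
  exists e : forall Z, E Z,
    (forall Z, existT E Z (e Z) = K Z) /\
    forall Z Z' (f : hom Z Z'), R f (e Z) (e Z').
Proof.
(* With a variable [H] in place of the composite, the equality [H = Id] can
   be eliminated. *)
have gen (H : functor D D) (e : forall Z, E (H Z)) :
    (forall Z Z' (f : hom Z Z'), R (fmap H f) (e Z) (e Z')) ->
    H = id_functor D ->
    exists e' : forall Z, E Z,
      (forall Z, existT E Z (e' Z) = existT E (H Z) (e Z)) /\
      forall Z Z' (f : hom Z Z'), R f (e' Z) (e' Z').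
  by move=> He eH; move: e He; rewrite eH /= => e He; exists e.
move=> eK; have [] := gen (comp_functor str_forget K) (fun Z => projT2 (K Z)) _ eK.
  by move=> Z Z' f; exact: (svalP (fmap K f)).
by move=> e [eE eR]; exists e; split=> // Z; rewrite eE /=; case: (K Z).
Qed.

Section Lift.
Variables (C : category) (L : functor C D) (e : forall X, E (L X)).
Hypothesis e_nat : forall X Y (f : hom X Y), R (fmap L f) (e X) (e Y).

Definition str_lift_hom (X Y : C) (f : hom X Y) :
    @hom str_cat (existT E (L X) (e X)) (existT E (L Y) (e Y)) :=
  exist _ (fmap L f) (e_nat f).

Lemma str_lift1 X : str_lift_hom (idm X) = idm _.
Proof. by apply: str_hom_eq; apply: fmap1. Qed.

Lemma str_liftM X Y Z (g : hom Y Z) (f : hom X Y) :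
  str_lift_hom (g \oc f) = str_lift_hom g \oc str_lift_hom f.
Proof. by apply: str_hom_eq; apply: fmapM. Qed.

Definition str_lift : functor C str_cat := Functor str_lift1 str_liftM.

Lemma forget_lift : comp_functor str_forget str_lift = L.
Proof.
transitivity (Functor (fmap1 L) (fmapM L)); last by case: (L).
exact: functor_data_eq.
Qed.
End Lift.
End StructuredObjects.

(** The strict universal property, applied twice: existence factors the lift
    of [L] through [D], and uniqueness shows that the factorization is a
    section, since both it (after forgetting) and the identity extend [L]. *)
Theorem localization_section (C D : category) (L : functor C D)
    (S : mor_class C) (E : D -> Type)
    (R : forall X Y : D, hom X Y -> E X -> E Y -> Prop) :
  is_localization L S ->
  (forall X (e : E X), R X X (idm X) e e) ->
  (forall X Y Z (g : hom Y Z) (f : hom X Y) eX eY eZ,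
    R Y Z g eY eZ -> R X Y f eX eY -> R X Z (g \oc f) eX eZ) ->
  (forall X Y (f : hom X Y) (g : hom Y X) eX eY,
    g \oc f = idm X -> f \oc g = idm Y -> R X Y f eX eY -> R Y X g eY eX) ->
  forall e : (forall X : C, E (L X)),
  (forall X Y (f : hom X Y), R _ _ (fmap L f) (e X) (e Y)) ->
  exists e' : forall Z, E Z,
    (forall Z Z' (f : hom Z Z'), R Z Z' f (e' Z) (e' Z')) /\
    forall X, e' (L X) = e X.
Proof.
move=> [Linv Luniv] R1 RM RV e eR.
pose LL := str_lift R1 RM eR.
have LLinv : inverts LL S.
  move=> X Y f /Linv[g [gf fg]].
  exists (exist _ g (RV _ _ _ _ _ _ gf fg (eR _ _ f))).
  by split; apply: str_hom_eq.
have [K [KL _]] := Luniv _ _ LLinv.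
have [J [_ Juniq]] := Luniv _ _ Linv.
have PK : comp_functor (str_forget R1 RM) K = id_functor D.
  rewrite -(Juniq (id_functor D)) ?comp_id_functor//.
  by apply/esym/Juniq; rewrite -comp_functorA KL forget_lift.
have [e' [e'E e'R]] := section_of_forget PK.
exists e'; split=> // X.
(* Both structures sit on the same object, so the transport that comes from
   the equality of dependent pairs is along a loop, which is trivial. *)
have eX : existT E (L X) (e' (L X)) = existT E (L X) (e X).
  by rewrite e'E; exact: (congr1 (fun H : functor _ _ => H X) KL).
have := projT2_eq eX; rewrite /=.
by rewrite (Prop_irrelevance (projT1_eq eX) erefl).
Qed.

(** The two consequences of being a localization that the descent of the
    adjunction uses.  They pass to the composite of a localization with an
    ideal quotient, so the descent can work with [Q_A] and [Q_B] directly. *)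
Definition nat_extension (C D : category) (Q : functor C D) : Prop :=
  forall (T : category) (K0 K1 : functor D T)
    (t : forall X : C, hom (K0 (Q X)) (K1 (Q X))),
  (forall X Y (f : hom X Y),
    t Y \oc fmap K0 (fmap Q f) = fmap K1 (fmap Q f) \oc t X) ->
  exists t' : forall Z, hom (K0 Z) (K1 Z),
    (forall Z Z' (f : hom Z Z'), t' Z' \oc fmap K0 f = fmap K1 f \oc t' Z) /\
    forall X, t' (Q X) = t X.

Definition ob_induction (C D : category) (Q : functor C D) : Prop :=
  forall P : D -> Prop, (forall X, P (Q X)) -> forall Z, P Z.

Lemma localization_ob_ind (C D : category) (L : functor C D)
    (S : mor_class C) : is_localization L S -> ob_induction L.
Proof.
move=> locL P PL.
by have [|||//|e _ Z] :=
  @localization_section _ _ L S P (fun _ _ _ _ _ => True) locL _ _ _ PL.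
Qed.

Lemma localization_extend_nat (C D : category) (L : functor C D)
    (S : mor_class C) : is_localization L S -> nat_extension L.
Proof.
move=> locL T K0 K1 t tn.
apply: (@localization_section _ _ L S (fun Z => hom (K0 Z) (K1 Z))
  (fun Z Z' f tZ tZ' => tZ' \oc fmap K0 f = fmap K1 f \oc tZ)) => //.
- by move=> X a; rewrite !fmap1 comp1m compm1.
- move=> X Y Z g f a b c hg hf.
  by rewrite !fmapM compmA hg -compmA hf compmA.
(* conjugate the naturality square of [f] by the inverse of [f] *)
move=> X Y f g a b gf fg h.
rewrite -[LHS]comp1m -(fmap_cancel K1 gf) -compmA; congr (_ \oc _).
by rewrite compmA -h -compmA (fmap_cancel K0 fg) compm1.
Qed.

(** * Adjunctions *)

Section AdjointDescent.
Variables (A B At Bt : category) (QA : functor A At) (QB : functor B Bt).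
Variables (F : functor A B) (G : functor B A).
Variables (Ft : functor At Bt) (Gt : functor Bt At).

(** Write [i : Ft QA -> QB F] and [j : Gt QB -> QA G] for the natural
    isomorphisms that the equalities provide.  On images, the extended unit and
    counit are the given ones composed with [i], [j] and their inverses; these
    cancel in each triangle because the extensions are also natural with
    respect to the components of [i] and [j]. *)
Theorem adjoint_descent :
  nat_extension QA -> ob_induction QA -> nat_extension QB -> ob_induction QB ->
  comp_functor Ft QA = comp_functor QB F ->
  comp_functor Gt QB = comp_functor QA G ->
  is_adjoint F G -> is_adjoint Ft Gt.
Proof.
move=> extA indA extB indB /eq_functor_iso[i [i' [in_ i'n i'i ii']]].
move=> /eq_functor_iso[j [j' [jn j'n j'j jj']]] [eta [eps [un cn tl tr]]].
move: in_ i'n i'i ii' jn j'n j'j jj' => /= in_ i'n i'i ii' jn j'n j'j jj'.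
have [|et [etn etE]] := extA _ (id_functor At) (comp_functor Gt Ft)
  (fun X => fmap Gt (i' X) \oc j' (F X) \oc fmap QA (eta X)).
  move=> /= X Y f.
  rewrite -compmA -fmapM un fmapM compmA -[_ \oc j' _ \oc _]compmA j'n.
  by rewrite !compmA -!fmapM i'n.
have [|ep [epn epE]] := extB _ (comp_functor Ft Gt) (id_functor Bt)
  (fun Y => fmap QB (eps Y) \oc i (G Y) \oc fmap Ft (j Y)).
  move=> /= X Y f.
  rewrite -compmA -fmapM jn fmapM compmA -[_ \oc i _ \oc _]compmA in_.
  by rewrite !compmA -!fmapM cn.
rewrite /= in etn etE epn epE.
exists et, ep; split.
- by move=> X X' f; rewrite etn.
- by move=> Y Y' g; rewrite epn.
- apply: indA => X.
  (* cancel the isomorphism [i X] on the left *)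
  rewrite -[LHS]comp1m -(i'i X) -!compmA; congr (_ \oc _).
  rewrite compmA -epn epE etE !fmapM -!compmA.
  rewrite [fmap Ft (fmap Gt (i X)) \oc _]compmA.
  rewrite (fmap_cancel Ft (fmap_cancel Gt (ii' X))) comp1m.
  rewrite [fmap Ft (j _) \oc _]compmA (fmap_cancel Ft (jj' _)) comp1m.
  by rewrite in_ compmA (fmap_cancel QB (tl X)) comp1m.
apply: indB => Y.
(* cancel the isomorphism [j Y] on the right *)
rewrite -[LHS]compm1 -(j'j Y) compmA; congr (_ \oc _).
rewrite -compmA etn etE epE !fmapM -!compmA.
rewrite [fmap Gt (fmap Ft (j Y)) \oc _]compmA.
rewrite (fmap_cancel Gt (fmap_cancel Ft (jj' Y))) comp1m.
rewrite [fmap Gt (i _) \oc _]compmA (fmap_cancel Gt (ii' _)) comp1m.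
by rewrite compmA -j'n -compmA (fmap_cancel QA (tr Y)) compm1.
Qed.
End AdjointDescent.

(** * Localizations of extriangulated categories *)

Section ExtLocalization.
Variables (A : extriangulated) (I : mor_class A) (hI : cond_M0 I).
Variable L : ext_localization hI.

Lemma loc_Q_inverts : inverts (loc_Q L) I.
Proof.
move=> X Y f If; apply: (proj1 (loc_funP L)).
by apply: BarImage; apply: ImageClass.
Qed.

(** The ideal quotient has the objects of [A] and its morphisms are classes of
    morphisms of [A], so naturality may be tested on representatives. *)
Lemma loc_Q_extension : nat_extension (loc_Q L).
Proof.
move=> T K0 K1 t tn; apply: (localization_extend_nat (loc_funP L)).
by move=> X Y f; rewrite -(qreprK f); exact: tn.
Qed.

Lemma loc_Q_induction : ob_induction (loc_Q L).
Proof. exact: (localization_ob_ind (loc_funP L)). Qed.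

Lemma loc_factor (D : extriangulated) (H : exact_functor A D) :
  inverts H I ->
  exists K : functor L D, is_exact K /\ comp_functor K (loc_Q L) = H.
Proof.
move=> Hinv; have [K [KH _]] := loc_universal L Hinv.
by exists K; split; [split; exact: ef_str | rewrite -KH].
Qed.
End ExtLocalization.

Lemma loc_functor (A B : extriangulated) (IA : mor_class A) (IB : mor_class B)
    (hA0 : cond_M0 IA) (hB0 : cond_M0 IB)
    (At : ext_localization hA0) (Bt : ext_localization hB0)
    (F : functor A B) :
  is_exact F ->
  (forall (X Y : A) (f : hom X Y), IA X Y f -> IB (F X) (F Y) (fmap F f)) ->
  exists Ft : functor At Bt, is_exact Ft /\
    comp_functor Ft (loc_Q At) = comp_functor (loc_Q Bt) F.
Proof.
move=> [sF] FI.
apply: (@loc_factor _ _ _ At _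
  (comp_exact (ExactFunctor (loc_mu Bt)) (ExactFunctor sF))).
by move=> X Y f /FI; exact: loc_Q_inverts.
Qed.

Theorem theorem3p4 (A B : extriangulated)
    (IA : mor_class A) (IB : mor_class B)
    (hA0 : cond_M0 IA) (hB0 : cond_M0 IB)
    (hAbar : cond_bar hA0) (hBbar : cond_bar hB0)
    (hA1 : cond_MR1 hA0) (hB1 : cond_MR1 hB0)
    (hA2 : cond_MR2 hA0) (hB2 : cond_MR2 hB0)
    (hA3 : cond_MR3 hA0) (hB3 : cond_MR3 hB0)
    (hA4 : cond_MR4 hA0) (hB4 : cond_MR4 hB0)
    (At : ext_localization hA0) (Bt : ext_localization hB0)
    (F : functor A B) (G : functor B A)
    (hF : is_exact F)
    (hFI : forall (X Y : A) (f : hom X Y),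
      IA X Y f -> IB (F X) (F Y) (fmap F f))
    (hFG : is_adjoint F G)
    (hG : is_exact G)
    (hGI : forall (X Y : B) (f : hom X Y),
      IB X Y f -> IA (G X) (G Y) (fmap G f)) :
  exists (Ft : functor At Bt) (Gt : functor Bt At),
    is_adjoint Ft Gt /\ is_exact Ft /\ is_exact Gt /\
    comp_functor Ft (loc_Q At) = comp_functor (loc_Q Bt) F /\
    comp_functor Gt (loc_Q Bt) = comp_functor (loc_Q At) G.
Proof.
have [Ft [exFt FtQ]] := loc_functor At Bt hF hFI.
have [Gt [exGt GtQ]] := loc_functor Bt At hG hGI.
exists Ft, Gt; split=> //.
apply: adjoint_descent FtQ GtQ hFG.
- exact: loc_Q_extension.
- exact: loc_Q_induction.
- exact: loc_Q_extension.
- exact: loc_Q_induction.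
Qed.
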